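(* Let $H:\mathfrak H_1=\mathrm{dom}(H)\subseteq\mathcal F\to\mathcal F$ be a bounded-from-below self-adjoint operator in a Hilbert space $\mathcal F$, let $A\in\mathcal B(\mathfrak H_1,\mathcal F)$ satisfy $\mathrm{ran}(G_z)\cap\mathfrak H_1=\{0\}$ for all $z\in\varrho(H)$, where $G_z=(AR_{\bar z})^*$, let $S:\mathrm{dom}(S)\subseteq\mathcal F\to\mathcal F$ be a symmetric operator with $\mathrm{dom}(S)\supseteq\mathfrak H_1$, and let $\lambda_\circ<\inf\sigma(H)$ be real. If $\lambda_\circ\in Z_S$, then $$R_z+\mathbf G_z\big(\mathbf\Theta_S+\mathbf M_z\big)^{-1}\mathbf G_{\bar z}^*\,,\qquad z\in Z_S\,,$$ is the resolvent of a self-adjoint operator; i.e., there is a self-adjoint operator $L$ in $\mathcal F$ such that for every $z\in Z_S$ one has $z\in\varrho(L)$ and $(-L+z)^{-1}=R_z+\mathbf G_z(\mathbf\Theta_S+\mathbf M_z)^{-1}\mathbf G_{\bar z}^*$.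
   Context: $\mathcal B(X,Y)$ denotes bounded linear operators from $X$ to $Y$; $\varrho$, $\sigma$ denote resolvent set and spectrum. For $s\in[-1,1]$, $\mathfrak H_s$ is the completion of $\mathrm{dom}(H)$ with respect to the scalar product $\langle\psi_1,\psi_2\rangle_s=\langle(H^2+1)^{s/2}\psi_1,(H^2+1)^{s/2}\psi_2\rangle$; so $\mathfrak H_0=\mathcal F$, $\mathfrak H_1=\mathrm{dom}(H)$, and $\mathfrak H_{-s}$ is identified with the (anti-)dual of $\mathfrak H_s$ via the pairing extending the scalar product of $\mathcal F$. Likewise $\mathcal F\oplus\mathfrak H_{-s}$ and $\mathcal F\oplus\mathfrak H_{s}$ are dual to each other. All adjoints are taken with respect to these dualities. For $z\in\varrho(H)$: $R_z:=(-H+z)^{-1}$, which extends to a bounded map $\mathfrak H_{-1}\to\mathcal F$; $G_z:=(AR_{\bar z})^*\in\mathcal B(\mathcal F)$, equivalently $G_z=R_zA^*$ with $A^*:\mathcal F\to\mathfrak H_{-1}$. One has $\mathrm{ran}(G_w-G_z)\subseteq\mathfrak H_1$ for $w,z\in\varrho(H)$. $\mathbf A:\mathfrak H_1\to\mathcal F\oplus\mathfrak H_1$, $\mathbf A\psi:=A\psi\oplus\psi$. $\mathbf G_z:=(\mathbf A R_{\bar z})^*:\mathcal F\oplus\mathfrak H_{-1}\to\mathcal F$, i.e. $\mathbf G_z(\psi\oplus\varphi)=G_z\psi+R_z\varphi$. With the fixed real $\lambda_\circ<\inf\sigma(H)$ set $R:=R_{\lambda_\circ}$, $G:=G_{\lambda_\circ}$,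 $\mathbf G:=\mathbf G_{\lambda_\circ}$, and $$\mathbf M_z:=\mathbf A(\mathbf G-\mathbf G_z):\mathcal F\oplus\mathfrak H_{-1}\to\mathcal F\oplus\mathfrak H_1\,,$$ which is a bounded operator. Let $\mathfrak D:=\{\psi\in\mathcal F:(1-G)\psi\in\mathfrak H_1\}$, $T_S:=(1-G^* )S(1-G)$ on $\mathfrak D$, and $$\mathbf\Theta_S:=\begin{bmatrix}T_S&1-G^*\\1-G&-R\end{bmatrix}:\mathfrak D\oplus\mathcal F\subseteq\mathcal F\oplus\mathfrak H_{-1}\to\mathcal F\oplus\mathfrak H_1\,.$$ The operator $\mathbf\Theta_S+\mathbf M_z$ has domain $\mathfrak D\oplus\mathcal F$, and $$Z_S:=\{z\in\varrho(H):(\mathbf\Theta_S+\mathbf M_z)^{-1}\in\mathcal B(\mathcal F\oplus\mathfrak H_1,\mathcal F\oplus\mathfrak H_{-1})\}\,,$$ i.e. $z\in Z_S$ iff $\mathbf\Theta_S+\mathbf M_z:\mathfrak D\oplus\mathcal F\to\mathcal F\oplus\mathfrak H_1$ is a bijection whose inverse is bounded from $\mathcal F\oplus\mathfrak H_1$ to $\mathcal F\oplus\mathfrak H_{-1}$. *)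

(* Defs.v *)
From HB Require Import structures.
From mathcomp Require Import all_boot all_order all_algebra.
From mathcomp Require Import sesquilinear complex.
From mathcomp Require Import all_classical all_reals all_analysis.

Set Implicit Arguments.
Unset Strict Implicit.
Unset Printing Implicit Defensive.

Import Order.TTheory GRing.Theory Num.Theory numFieldNormedType.Exports.

Local Open Scope classical_set_scope.
Local Open Scope complex_scope.
Local Open Scope ring_scope.

Section DotTheory.
Variables (C : numClosedFieldType) (U : lmodType C).
Variable form : {dot U for Num.conj}.

Lemma dot_CauchySchwarz u v : `|form u v| ^+ 2 <= form u u * form v v.
Proof.
have [->|v0] := eqVneq v 0.
  by rewrite linear0r normr0 expr0n mulr_ge0 ?dnorm_ge0.
have vv : form v v != 0 by rewrite dnorm_eq0.
pose a := form u v / form v v; pose w := u - a *: v.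
have wv : form w v = 0.
  by rewrite linearBl /= linearZl_LR /= /a divfK // subrr.
have -> : u = w + a *: v by rewrite /w subrK.
have av : form w (a *: v) = 0 by rewrite linearZr_LR /= wv mulr0.
rewrite dnormD av rmorph0 !addr0 dnormZ linearDl /= wv add0r linearZl_LR /=.
rewrite normrM exprMn (ger0_norm (dnorm_ge0 _ v)) mulrDl.
by rewrite -[X in _ <= _ + X]mulrA -expr2 lerDr mulr_ge0 ?dnorm_ge0.
Qed.

Lemma dot_CauchySchwarz_sqrt u v :
  `|form u v| <= sqrtC (form u u) * sqrtC (form v v).
Proof.
rewrite -(ler_pXn2r (n := 2)) ?nnegrE ?mulr_ge0 ?sqrtC_ge0 ?dnorm_ge0 //.
by rewrite exprMn !sqrtCK dot_CauchySchwarz.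
Qed.

Lemma dot_ler_normD u v :
  sqrtC (form (u + v) (u + v)) <= sqrtC (form u u) + sqrtC (form v v).
Proof.
rewrite -(ler_pXn2r (n := 2)) ?nnegrE ?addr_ge0 ?sqrtC_ge0 ?dnorm_ge0 //.
rewrite sqrtCK sqrrD !sqrtCK dnormD /= [leRHS]addrAC lerD2l.
set d := form u v.
have dr : d + d^*%R \is Num.real.
  by apply/CrealP; rewrite rmorphD /= conjCK addrC.
apply: le_trans (real_ler_norm dr) _; apply: le_trans (ler_normD _ _) _.
by rewrite norm_conjC -mulr2n lerMn2r dot_CauchySchwarz_sqrt orbT.
Qed.

Lemma dot_normZ a u :
  sqrtC (form (a *: u) (a *: u)) = `|a| * sqrtC (form u u).
Proof.
by rewrite dnormZ sqrtCM ?nnegrE ?exprn_ge0 ?dnorm_ge0 // sqrCK.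
Qed.

Lemma dot_norm_eq0 u : sqrtC (form u u) = 0 -> u = 0.
Proof. by move=> /eqP; rewrite sqrtC_eq0 dnorm_eq0 => /eqP. Qed.

End DotTheory.

(* As in MathComp, scalar products are linear in the first argument and
   antilinear in the second one. *)
HB.mixin Record hasInner (R : realType) V & NormedModule R[i] V := {
  inner : {dot V for Num.conj};
  sqr_norm_inner : forall x : V, `|x| ^+ 2 = inner x x;
}.

#[short(type="innerProductType")]
HB.structure Definition InnerProduct (R : realType) :=
  {V of NormedModule R[i] V & hasInner R V}.

#[short(type="hilbertType")]
HB.structure Definition Hilbert (R : realType) :=
  {V of CompleteNormedModule R[i] V & hasInner R V}.

Notation "''[' x , y ]" := (inner x y) : ring_scope.

Definition bounded_op (R : realType) (V W : normedModType R[i]) (f : V -> W) :=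
  exists M : R, forall x, `|f x| <= M%:C * `|x|.

(* [adjoint pX pY B] is the adjoint of [B : X -> Y], where [pX] and [pY] are
   the (sesquilinear, nondegenerate) pairings of [X] and [Y] with their
   antiduals [X'] and [Y'].  It is meaningful when [B] is a bounded operator
   and the pairings represent all bounded antilinear functionals. *)
Definition adjoint (C : Type) (X Y : Type) (X' : zmodType) (Y' : Type)
    (pX : X' -> X -> C) (pY : Y' -> Y -> C) (B : X -> Y) (y' : Y') : X' :=
  xget 0 [set x' | forall x, pX x' x = pY y' (B x)].

Section Antidual.
Variables (R : realType) (V : normedModType R[i]).

Definition antilinear_bounded : {pred V -> R[i]} := fun phi =>
  `[< (forall a x y, phi (a *: x + y) = a^*%R * phi x + phi y) /\
      exists M : R, forall x, `|phi x| <= M%:C * `|x| >].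

Record antidual := Antidual {
  antidual_fun :> V -> R[i];
  antidualP : antidual_fun \in antilinear_bounded
}.

HB.instance Definition _ := [isSub for antidual_fun].
HB.instance Definition _ := [Choice of antidual by <:].

Lemma antilinear_bounded_submod : submod_closed antilinear_bounded.
Proof.
split.
  apply/asboolP; split=> [a x y|]; first by rewrite mulr0 addr0.
  by exists 0 => x; rewrite normr0 mul0r.
move=> /= b f g /asboolP[flin [M fM]] /asboolP[glin [N gN]].
apply/asboolP; split=> [a x y|].
  rewrite !fctE /= flin glin /GRing.scale/= !mulrDr mulrCA !addrA.
  by congr (_ + _); rewrite -!addrA; congr (_ + _); rewrite addrC.
pose b' := complex.Re `|b|; have b'E : `|b| = b'%:C by rewrite RRe_real.
exists (b' * M + N) => x.
rewrite rmorphD rmorphM /= mulrDl -b'E -mulrA.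
by apply: le_trans (ler_normD _ _) _; rewrite lerD // normrM ler_wpM2l.
Qed.
HB.instance Definition _ :=
  GRing.isSubmodClosed.Build _ _ antilinear_bounded antilinear_bounded_submod.
HB.instance Definition _ := [SubChoice_isSubLmodule of antidual by <:].

(* The dual norm; `|phi x| is a nonnegative real element of R[i]. *)
Definition antidual_norm (phi : antidual) : R[i] :=
  (sup [set complex.Re `|phi x| | x in [set x : V | `|x| <= 1]])%:C.

Let vals (phi : antidual) :=
  [set complex.Re `|phi x| | x in [set x : V | `|x| <= 1]].

Let vals0 phi : vals phi !=set0.
Proof. by exists (complex.Re `|phi 0|), 0; rewrite //= normr0. Qed.

Let vals_ub phi : has_ubound (vals phi).
Proof.
have /asboolP[_ [M phiM]] := antidualP phi.
exists `|M| => _ [x x1 <-].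
rewrite -lecR RRe_real ?normr_real //.
apply: (le_trans (phiM x)); apply: (@le_trans _ _ (`|M|%:C * `|x|)).
  by rewrite ler_wpM2r ?lecR ?ler_norm.
by rewrite ler_piMr // lecR.
Qed.

Lemma antidual_norm_le (phi : antidual) (M : R[i]) : M \is Num.real ->
  (forall x, `|x| <= 1 -> `|phi x| <= M) -> antidual_norm phi <= M.
Proof.
move=> Mr phiM; rewrite -(RRe_real Mr) lecR; apply: ge_sup; first exact: vals0.
move=> _ [x x1 <-]; rewrite -lecR !RRe_real ?normr_real //; exact: phiM.
Qed.

Lemma antidual_norm_ub1 (phi : antidual) x :
  `|x| <= 1 -> `|phi x| <= antidual_norm phi.
Proof.
move=> x1; rewrite -(RRe_real (normr_real (phi x))) lecR.
by apply: ub_le_sup; [exact: vals_ub|exists x].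
Qed.

Lemma antidual_norm_real (phi : antidual) : antidual_norm phi \is Num.real.
Proof. by rewrite complex_real. Qed.

Lemma antidual_ler_normD (phi psi : antidual) :
  antidual_norm (phi + psi) <= antidual_norm phi + antidual_norm psi.
Proof.
apply: antidual_norm_le => [|x x1]; first by rewrite rpredD ?antidual_norm_real.
apply: (le_trans (ler_normD _ _)).
by apply: lerD; exact: antidual_norm_ub1.
Qed.

Let antidual_normZ_le a (phi : antidual) :
  antidual_norm (a *: phi) <= `|a| * antidual_norm phi.
Proof.
apply: antidual_norm_le => [|x x1].
  by rewrite rpredM ?antidual_norm_real ?normr_real.
by rewrite [X in `|X|](_ : _ = a * phi x) // normrM ler_wpM2l ?antidual_norm_ub1.
Qed.

Lemma antidual_normZ a (phi : antidual) :
  antidual_norm (a *: phi) = `|a| * antidual_norm phi.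
Proof.
apply/eqP; rewrite eq_le antidual_normZ_le /=.
have [->|a0] := eqVneq a 0.
  rewrite normr0 mul0r scale0r; have := @antidual_norm_ub1 0 0.
  by rewrite normr0 => /(_ ler01); apply: le_trans.
rewrite -ler_pdivlMl ?normr_gt0 // -normfV.
by rewrite -[X in antidual_norm X <= _]scale1r -(mulVf a0) -scalerA.
Qed.

Lemma antidual_eval0 (phi : antidual) : phi 0 = 0.
Proof.
have /asboolP[lin _] := antidualP phi.
by have := lin (-1) 0 0; rewrite scaler0 addr0 rmorphN1 mulN1r addNr.
Qed.

Lemma antidual_norm_eq0 (phi : antidual) : antidual_norm phi = 0 -> phi = 0.
Proof.
move=> phi0; apply: val_inj; apply/funext => x /=.
have /asboolP[lin _] := antidualP phi.
have [->|x0] := eqVneq x 0; first exact: antidual_eval0.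
have := @antidual_norm_ub1 phi (`|x|^-1 *: x).
rewrite normrZ normfV normr_id mulVf ?normr_eq0 // phi0 => /(_ (lexx _)).
rewrite normr_le0 -[_ *: x]addr0 lin antidual_eval0 addr0 mulf_eq0 => /orP[|/eqP//].
by rewrite conjC_eq0 invr_eq0 normr_eq0 (negPf x0).
Qed.

HB.instance Definition _ := Lmodule_isNormed.Build R[i] antidual
  antidual_ler_normD antidual_normZ antidual_norm_eq0.

End Antidual.

Section InnerTheory.
Variables (R : realType) (V : innerProductType R).

Lemma inner_linearr (x : V) a y z :
  '[x, a *: y + z] = a^*%R * '[x, y] + '[x, z].
Proof. by rewrite linearDr linearZr_LR. Qed.

Lemma inner_linearl (y : V) a x z :
  '[a *: x + z, y] = a * '[x, y] + '[z, y].
Proof. by rewrite linearDl linearZl_LR. Qed.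

Lemma innerC (x y : V) : '[x, y] = ('[y, x])^*%R.
Proof. by rewrite hermC expr0 mul1r. Qed.

End InnerTheory.

Section Unbounded.
Variables (R : realType) (F : hilbertType R).

(* A linear operator [app : dom -> F]; the values of [app] outside of the
   subspace [dom] carry no information. *)
Record operator := Operator {
  dom : set F;
  app :> F -> F;
  dom0 : dom 0;
  domP : forall a x y, dom x -> dom y -> dom (a *: x + y);
  appP : forall a x y, dom x -> dom y -> app (a *: x + y) = a *: app x + app y
}.

Definition symmetric_op (T : operator) :=
  dense (dom T) /\
  forall x y, dom T x -> dom T y -> '[T x, y] = '[x, T y].

(* The graph of the Hilbert space adjoint of a densely defined operator. *)
Definition adj_graph (T : operator) (y w : F) :=
  forall x, dom T x -> '[T x, y] = '[x, w].

Definition selfadjoint (T : operator) :=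
  dense (dom T) /\ forall y w, adj_graph T y w <-> dom T y /\ w = T y.

Definition bounded_below (T : operator) :=
  exists c : R, forall x, dom T x -> c%:C * `|x| ^+ 2 <= '[T x, x].

(* (-T + z)^-1 *)
Definition resolvent (T : operator) (z : R[i]) : F -> F :=
  'pinv_(fun=> 0) (dom T) (fun x => - T x + z *: x).

Definition resolvent_set (T : operator) : set R[i] :=
  [set z | set_bij (dom T) setT (fun x => - T x + z *: x) /\
           bounded_op (resolvent T z)].

Definition spectrum (T : operator) : set R[i] := ~` resolvent_set T.

(* The spectrum of a self-adjoint operator is real; its infimum is +oo if it
   is empty, that is, if F = 0. *)
Definition inf_spectrum (T : operator) : \bar R :=
  ereal_inf [set x%:E | x in [set x : R | spectrum T x%:C]].

End Unbounded.

Section Scale.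
Variables (R : realType) (F : hilbertType R) (H : operator F).

Definition in_dom : {pred F} := fun x => `[< dom H x >].

Record H1 := MkH1 { H1val :> F; H1valP : H1val \in in_dom }.
HB.instance Definition _ := [isSub for H1val].
HB.instance Definition _ := [Choice of H1 by <:].

Lemma in_dom_submod : submod_closed in_dom.
Proof.
split; first exact/asboolP/dom0.
by move=> a x y /asboolP dx /asboolP dy; apply/asboolP/domP.
Qed.
HB.instance Definition _ := GRing.isSubmodClosed.Build _ _ in_dom in_dom_submod.
HB.instance Definition _ := [SubChoice_isSubLmodule of H1 by <:].

Lemma H1dom (x : H1) : dom H x.
Proof. exact/asboolP/H1valP. Qed.

Definition H1app (x : H1) : F := H x.

Let H1app_linear : linear H1app.
Proof. by move=> a x y; rewrite /H1app /= appP //; exact: H1dom. Qed.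
HB.instance Definition _ := GRing.isLinear.Build _ _ _ _ H1app H1app_linear.

(* For self-adjoint H and x, y in dom H this is
   <(H^2 + 1)^(1/2) x, (H^2 + 1)^(1/2) y>; dom H is complete for it because H
   is closed, so that H_1 is dom H itself. *)
Definition H1inner (x y : H1) : R[i] :=
  '[H1app x, H1app y] + '[val x, val y].

Let H1inner_linearr x : linear_for (Num.conj \; *%R) (H1inner x).
Proof.
move=> a y z; rewrite /H1inner H1app_linear /= !inner_linearr /=.
by rewrite mulrDr addrACA.
Qed.

Let H1inner_linearl y : linear_for *%R (H1inner^~ y).
Proof.
move=> a x z; rewrite /H1inner H1app_linear /= !inner_linearl /=.
by rewrite mulrDr addrACA.
Qed.

HB.instance Definition _ := bilinear_isBilinear.Build R[i] H1 H1 R[i]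
  *%R (Num.conj \; *%R) H1inner (H1inner_linearl, H1inner_linearr).

Let H1inner_herm x y : H1inner x y = (-1) ^+ false * (H1inner y x)^*%R.
Proof.
by rewrite expr0 mul1r /H1inner rmorphD /= -!innerC.
Qed.
HB.instance Definition _ := isHermitianSesquilinear.Build _ _ _ _ H1inner
  H1inner_herm.

Let H1inner_dot x : x != 0 -> 0 < H1inner x x.
Proof.
move=> x0; rewrite ltr_wpDl ?dnorm_ge0 //.
by apply: neq0_dnorm_gt0.
Qed.
HB.instance Definition _ := isDotProduct.Build _ _ H1inner H1inner_dot.

HB.instance Definition _ := Lmodule_isNormed.Build R[i] H1
  (dot_ler_normD H1inner) (dot_normZ H1inner) (dot_norm_eq0 (form:=H1inner)).

Let sqr_H1norm x : `|x| ^+ 2 = (H1inner : {dot H1 for Num.conj}) x x.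
Proof. by rewrite sqrtCK. Qed.
HB.instance Definition _ := hasInner.Build R H1 sqr_H1norm.

Definition toH1 (x : F) : H1 := insubd 0 x.

(* The completion of F for <(H^2 + 1)^(-1/2) x, (H^2 + 1)^(-1/2) y>, identified
   with the antidual of H_1 as in [embed] below. *)
Definition Hm1 : Type := antidual H1.
HB.instance Definition _ := NormedModule.on Hm1.

End Scale.

Section Model.
Variables (R : realType) (F : hilbertType R) (H : operator F).
Implicit Types (z : R[i]) (f psi : F).

Let embed_subproof (f : F) :
  (fun x : H1 H => '[f, val x]) \in @antilinear_bounded R (H1 H).
Proof.
apply/asboolP; split=> [a x y|]; first by rewrite /= inner_linearr.
exists (complex.Re `|f|) => x; rewrite RRe_real ?normr_real //.
have normE (V : innerProductType R) (v : V) : `|v| = sqrtC '[v, v].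
  by rewrite -sqr_norm_inner sqrCK.
apply: (le_trans (dot_CauchySchwarz_sqrt inner _ _)).
rewrite -!normE ler_wpM2l // !normE ler_sqrtC ?nnegrE ?dnorm_ge0 //.
by rewrite lerDr dnorm_ge0.
Qed.

Definition embed f : Hm1 H := Antidual (embed_subproof f).

(* The duality between F (+) H_{-1} and F (+) H_1 extends the scalar product of
   F (+) F.  The library's norm on products is the maximum of the norms of the
   components, equivalent to the Hilbert sum norm; it only serves to express
   boundedness. *)
Definition pairing (v : F * Hm1 H) (u : F * H1 H) : R[i] :=
  '[v.1, u.1] + v.2 u.2.

Definition pairingC (u : F * H1 H) (v : F * Hm1 H) : R[i] := (pairing v u)^*%R.

(* R_z as an operator from F to H_1 *)
Definition resolventH1 z : F -> H1 H := fun f => toH1 H (resolvent H z f).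

Variables (A : H1 H -> F) (S : operator F) (l0 : R).

Definition G z : F -> F := adjoint inner inner (A \o resolventH1 z^*%R).

Definition bA (x : H1 H) : F * H1 H := (A x, x).

Definition bG z : F * Hm1 H -> F :=
  adjoint inner pairing (bA \o resolventH1 z^*%R).

Definition bG_adj z : F -> F * H1 H := adjoint pairingC inner (bG z).

(* bG l0 - bG z takes its values in H_1. *)
Definition bM z (v : F * Hm1 H) : F * H1 H :=
  bA (toH1 H (bG l0%:C v - bG z v)).

Let G0 : F -> F := G l0%:C.
Let G0_adj : F -> F := adjoint inner inner G0.

(* [G0_adj] plays the role of G^*, with G := [G0]. *)
Definition frakD : set F := [set psi | dom H (psi - G0 psi)].

Definition T_S psi : F :=
  let phi := S (psi - G0 psi) in phi - G0_adj phi.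

(* On the domain frakD (+) F. *)
Definition bTheta (p : F * F) : F * H1 H :=
  (T_S p.1 + (p.2 - G0_adj p.2),
   toH1 H (p.1 - G0 p.1) - resolventH1 l0%:C p.2).

Definition incl (p : F * F) : F * Hm1 H := (p.1, embed p.2).

Definition bThetaM z (p : F * F) : F * H1 H := bTheta p + bM z (incl p).

(* (bTheta + bM z)^-1 as an operator from F (+) H_1 to F (+) H_{-1} *)
Definition bThetaM_inv z : F * H1 H -> F * Hm1 H :=
  incl \o 'pinv_(fun=> 0) (frakD `*` setT) (bThetaM z).

Definition Z_S : set R[i] :=
  [set z | [/\ resolvent_set H z,
               set_bij (frakD `*` setT) setT (bThetaM z) &
               bounded_op (bThetaM_inv z)]].

End Model.

(* Main.v *)
(* The operator L is described by a relation that does not involve z: writing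
   G for bG l0, let [krein_graph g h] hold when g = g0 + G p with g0 in dom H
   and p in frakD (+) F such that Theta p = bA g0, and h = H g0 + l0 G p.
   Since G p - G_z p = (z - l0) R_z G p, the equation
   (Theta + M_z) p = bA R_z f is equivalent to [krein_graph g (z g - f)] for
   g = R_z f + G_z p, so for z in Z_S this relation is solved by exactly the g
   given by the resolvent formula.  The relation is symmetric because Theta
   is, it is single-valued because ran G_l0 meets dom H trivially, and l0 - L
   is onto for the real point l0; hence L is densely defined and self-adjoint.
   The adjoints are supplied by the Riesz representation theorem. *)
Require Import Defs.
From mathcomp Require Import all_boot all_order all_algebra.
From mathcomp Require Import sesquilinear complex.
From mathcomp Require Import all_classical all_reals all_analysis.
Set Implicit Arguments.
Unset Strict Implicit.
Unset Printing Implicit Defensive.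
Import Order.TTheory GRing.Theory Num.Theory numFieldNormedType.Exports.
Local Open Scope classical_set_scope.
Local Open Scope complex_scope.
Local Open Scope ring_scope.

(** * Orthogonal projection, density and Riesz representation in a Hilbert space *)

Section HilbertSpace.
Variables (R : realType) (F : hilbertType R).
Implicit Types (u v w x y : F) (V : set F).

Definition linear_subspace V :=
  V 0 /\ forall a x y, V x -> V y -> V (a *: x + y).

Lemma inner_normE x : '[x, x] = `|x| ^+ 2.
Proof. by rewrite sqr_norm_inner. Qed.

Lemma inner_le_norm x y : `|'[x, y]| <= `|x| * `|y|.
Proof.
apply: le_trans (dot_CauchySchwarz_sqrt inner x y) _.
by rewrite !inner_normE !sqrCK.
Qed.

Lemma inner_eq0 x : (forall y, '[x, y] = 0) -> x = 0.
Proof.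
move=> /(_ x) /eqP; rewrite inner_normE expf_eq0 /= normr_eq0; exact: eqP.
Qed.

Lemma inner_inj x y : (forall u, '[x, u] = '[y, u]) -> x = y.
Proof.
move=> xy; apply/eqP; rewrite -subr_eq0; apply/eqP/inner_eq0 => u.
by rewrite linearBl /= xy subrr.
Qed.

(* First-order optimality: minimise '|u - v - a x|' over the scalar [a]. *)
Lemma near_minimizer_orthogonal V u v (d e : R) : linear_subspace V -> 0 <= e ->
  (forall y, V y -> d%:C <= `|u - y| ^+ 2) ->
  V v -> `|u - v| ^+ 2 <= d%:C + e%:C ^+ 2 ->
  forall x, V x -> `|'[u - v, x]| <= e%:C * `|x|.
Proof.
move=> [V0 Vlin] e0 dmin Vv dv x Vx.
have [->|x0] := eqVneq x 0; first by rewrite linear0r !normr0 mulr0.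
have xx : '[x, x] != 0 by rewrite dnorm_eq0.
have xx0 : 0 < '[x, x] by rewrite lt_def xx dnorm_ge0.
set c := '[u - v, x]; pose a := c / '[x, x].
have /(dmin _) := Vlin a x v Vx Vv.
rewrite (_ : u - (a *: x + v) = (u - v) - a *: x); last first.
  by rewrite opprD addrCA addrC.
rewrite -inner_normE dnormB dnormZ /= linearZr_LR /= -/c.
have -> : a^* = c^* / '[x, x].
  by rewrite /a fmorph_div /= (CrealP (ger0_real (dnorm_ge0 _ _))).
have cE : c^* / '[x, x] * c = `|c| ^+ 2 / '[x, x] by rewrite normCK mulrC mulrA.
have cr : `|c| ^+ 2 / '[x, x] \is Num.real.
  by rewrite realM ?realX ?normr_real // realV ger0_real // dnorm_ge0.
rewrite cE (conj_Creal cr).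
have -> : `|a| ^+ 2 * '[x, x] = `|c| ^+ 2 / '[x, x].
  by rewrite /a normrM normfV (ger0_norm (dnorm_ge0 _ _)) exprMn -mulrA;
    congr (_ * _); rewrite expr2 -mulrA mulVf // mulr1.
rewrite opprD addrA addrK lerBrDr !inner_normE => dc.
have := le_trans dc dv; rewrite lerD2l ler_pdivrMr -?inner_normE //.
by rewrite inner_normE -exprMn ler_pXn2r // nnegrE // mulr_ge0 // lecR.
Qed.

(** A minimizing sequence for the distance from [u] to [V] converges; since [V] need not be closed,
    its limit only lies in the closure. The near-orthogonality of each error to [V] replaces the
    parallelogram law in the Cauchy estimate. *)
Lemma orthogonal_projection V u : linear_subspace V ->
  exists2 w, closure V w & forall x, V x -> '[u - w, x] = 0.
Proof.
move=> VS; have [V0 Vlin] := VS.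
pose D := [set complex.Re (`|u - v| ^+ 2) | v in V].
have DE v : (complex.Re (`|u - v| ^+ 2))%:C = `|u - v| ^+ 2.
  by rewrite RRe_real // realX // normr_real.
have Dlb : has_lbound D.
  by exists 0 => _ [v _ <-]; rewrite -lecR DE exprn_ge0.
have Dinf : has_inf D by split=> //; exists (complex.Re (`|u - 0| ^+ 2)), 0.
pose d := inf D.
have dmin y : V y -> d%:C <= `|u - y| ^+ 2.
  by move=> Vy; rewrite -DE lecR; apply: ge_inf => //; exists y.
pose e n : R := n.+1%:R^-1.
have e_gt0 n : 0 < e n by rewrite invr_gt0.
have /choice[v_ v_P] n : exists v, V v /\ `|u - v| ^+ 2 <= d%:C + (e n)%:C ^+ 2.
  (* The margin is the square of [e n], so that the orthogonality defect of [v_ n] is [e n]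
     itself. *)
  have [|_ [v Vv <-]] := inf_adherent _ Dinf (eps := e n ^+ 2).
    by rewrite exprn_gt0.
  by move=> /ltW; rewrite -lecR DE rmorphD rmorphXn /=; exists v.
have v_orth n := near_minimizer_orthogonal VS (ltW (e_gt0 n)) dmin
  (v_P n).1 (v_P n).2.
(* With x = v_m - v_n, which lies in [V], |x|^2 = <u - v_n, x> - <u - v_m, x>, and each term is at
   most its defect times |x|. *)
have v_near m n : `|v_ m - v_ n| <= (e m)%:C + (e n)%:C.
  set x := v_ m - v_ n.
  have Vx : V x by rewrite /x addrC -scaleN1r; apply: Vlin; apply v_P.
  have [->|x0] := eqVneq x 0; first by rewrite normr0 addr_ge0 // lecR ltW.
  rewrite -(ler_pM2r (x := `|x|)) ?normr_gt0 // -expr2 -inner_normE {1}/x.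
  rewrite (_ : v_ m - v_ n = (u - v_ n) - (u - v_ m)); last first.
    by rewrite opprB [RHS]addrC addrA subrK.
  rewrite linearBl /=.
  have r : '[u - v_ n, x] - '[u - v_ m, x] \is Num.real.
    rewrite -linearBl /= opprB addrC addrA subrK.
    by rewrite ger0_real // dnorm_ge0.
  apply: le_trans (real_ler_norm r) _; apply: le_trans (ler_normB _ _) _.
  by rewrite addrC mulrDl lerD // v_orth.
have e_lt (eps : R[i]) : 0 < eps -> \forall n \near \oo, (e n)%:C < eps.
  move=> eps0; have epsE := RRe_real (gtr0_real eps0).
  have eps'0 : 0 < complex.Re eps by rewrite -ltcR epsE.
  near=> n; rewrite -epsE ltcR; near: n.
  exact: (near_infty_natSinv_lt (PosNum eps'0)).
have vcvg : cvg (v_ n @[n --> \oo]).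
  apply: cauchy_cvg; apply: cauchy_exP => eps eps0.
  have eps2 : 0 < eps / 2 by rewrite divr_gt0.
  have [N _ NP] := e_lt _ eps2.
  exists (v_ N); exists N => // n Nn; rewrite -ball_normE /=.
  apply: le_lt_trans (v_near _ _) _; rewrite [ltRHS]splitr.
  by apply: ltrD; apply: NP => /=.
set w := lim (v_ n @[n --> \oo]) in vcvg; exists w.
  move=> B wB; have [n _ nP] := vcvg _ wB.
  by exists (v_ n); split; [exact: (v_P n).1|apply: nP => /=].
move=> x Vx; have [->|x0] := eqVneq x 0; first by rewrite linear0r.
apply/eqP; rewrite -normr_le0; apply/ler_addgt0Pl => eps eps0; rewrite addr0.
(* One half of [eps] pays for the defect of [v_ n], the other for the distance from [v_ n] to [w];
   both get multiplied by |x|. *)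
have eps' : 0 < eps / 2 / `|x| by rewrite !divr_gt0 // normr_gt0.
have [N _ NP] := e_lt _ eps'.
have [M _ MP] := (cvgrPdist_lt _ _).1 vcvg _ eps'.
pose n := maxn M N.
have -> : u - w = (u - v_ n) - (w - v_ n) by rewrite opprB addrA subrK.
rewrite linearBl /=; apply: le_trans (ler_normB _ _) _.
rewrite [leRHS]splitr lerD //.
  apply: le_trans (v_orth _ _ Vx) _; rewrite -ler_pdivlMr ?normr_gt0 //.
  by apply/ltW/NP; rewrite /= leq_maxr.
apply: le_trans (inner_le_norm _ _) _; rewrite -ler_pdivlMr ?normr_gt0 //.
by apply/ltW/MP; rewrite /= leq_maxl.
Unshelve. all: by end_near. Qed.

(** For any [u], the error u - w of its projection is orthogonal to [V], hence zero, so u = w lies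
    in the closure of [V]. *)
Lemma dense_orthogonal V : linear_subspace V ->
  (forall u, (forall x, V x -> '[u, x] = 0) -> u = 0) -> dense V.
Proof.
move=> VS Vperp O [u Ou] oO.
have [w cw wP] := orthogonal_projection u VS.
have /eqP := Vperp _ wP; rewrite subr_eq0 => /eqP uw.
by have := cw O; rewrite setIC; apply; rewrite -uw; apply: open_nbhs_nbhs.
Qed.

(** The kernel [N] of [phi] is closed by boundedness, so a [u] with phi u nonzero has a nonzero
    component [e] orthogonal to [N]; a multiple of [e] represents [phi]. *)
Lemma riesz (phi : F -> R[i]) (M : R) :
  (forall a x y, phi (a *: x + y) = a^* * phi x + phi y) ->
  (forall x, `|phi x| <= M%:C * `|x|) ->
  exists y, forall x, '[y, x] = phi x.
Proof.
move=> lin bnd.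
have phi0 : phi 0 = 0.
  by have := lin (-1) 0 0; rewrite scaler0 addr0 rmorphN1 mulN1r addNr.
have phiB x y : phi (x - y) = phi x - phi y.
  by rewrite addrC -scaleN1r lin rmorphN1 mulN1r addrC.
pose N : set F := [set x | phi x = 0].
have NS : linear_subspace N.
  by split=> // a x y Nx Ny; rewrite /N /= lin Nx Ny mulr0 addr0.
have Ncl : closure N `<=` N.
  move=> w cw; apply/eqP; rewrite -normr_le0; apply/ler_addgt0Pl => eps eps0.
  rewrite addr0.
  have M0 : 0 < `|M| + 1 by rewrite ltr_wpDl.
  have M0c : 0 < (`|M| + 1)%:C :> R[i] by rewrite ltcR.
  have [|v [Nv]] := cw (ball w (eps / (`|M| + 1)%:C)).
    by apply: nbhsx_ballx; rewrite divr_gt0.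
  rewrite -ball_normE /= => wv.
  have -> : phi w = phi (w - v) by rewrite phiB Nv subr0.
  apply: le_trans (bnd _) _; rewrite ltr_pdivlMr // mulrC in wv.
  apply: le_trans (ltW wv); rewrite ler_wpM2r // lecR.
  by apply: le_trans (ler_norm _) _; rewrite lerDl.
have [phi_eq0|/existsNP[u /eqP phiu]] :=
  pselect (forall x, phi x = 0).
  by exists 0 => x; rewrite linear0l phi_eq0.
have [w /Ncl Nw wP] := orthogonal_projection u NS.
set e := u - w in wP.
have phie : phi e = phi u by rewrite /e phiB Nw subr0.
have e0 : e != 0 by apply: contra_neq phiu => e0; rewrite -phie e0.
have ee : '[e, e] != 0 by rewrite dnorm_eq0.
exists ((phi e / '[e, e]) *: e) => x; rewrite linearZl_LR /=.
(* The coefficient is conjugated because [phi] is antilinear: this makes the vector an element of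
   the kernel. *)
have := wP (x - (phi x / phi e)^* *: e).
rewrite linearBr /= linearZr_LR /= conjCK => /(_ _)/eqP.
rewrite subr_eq0 => ex.
have ee' : phi e != 0 by rewrite phie.
rewrite (eqP (ex _)); last first.
  by rewrite /N /= phiB -[_ *: e]addr0 lin phi0 addr0 conjCK divfK ?subrr.
by rewrite [_ * '[e, e]]mulrC mulrA divfK // mulrC divfK.
Qed.

End HilbertSpace.

(** * Bounded maps, norms on products and antiduals, existence of adjoints *)

Section BoundedOp.
Variable (R : realType).
Implicit Types V W : normedModType R[i].

Lemma bounded_opI V W (f : V -> W) (C : R[i]) : 0 <= C ->
  (forall x, `|f x| <= C * `|x|) -> bounded_op f.
Proof.
by move=> C0 fC; exists (complex.Re C) => x; rewrite RRe_real ?ger0_real.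
Qed.

Lemma bounded_opE V W (f : V -> W) : bounded_op f ->
  exists2 C : R[i], 0 <= C & forall x, `|f x| <= C * `|x|.
Proof.
move=> [M fM]; exists `|M|%:C => [|x]; first by rewrite ler0c.
by apply: le_trans (fM x) _; rewrite ler_wpM2r // lecR ler_norm.
Qed.

Lemma bounded_op_comp V W (X : normedModType R[i]) (f : V -> W) (g : W -> X) :
  bounded_op f -> bounded_op g -> bounded_op (g \o f).
Proof.
move=> /bounded_opE[C C0 fC] /bounded_opE[D D0 gD].
apply: (@bounded_opI _ _ _ (D * C)) => [|x]; first exact: mulr_ge0.
by apply: le_trans (gD _) _; rewrite -mulrA ler_wpM2l.
Qed.

Lemma bounded_opD V W (f g : V -> W) :
  bounded_op f -> bounded_op g -> bounded_op (fun x => f x + g x).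
Proof.
move=> /bounded_opE[C C0 fC] /bounded_opE[D D0 gD].
apply: (@bounded_opI _ _ _ (C + D)) => [|x]; first exact: addr_ge0.
by apply: le_trans (ler_normD _ _) _; rewrite mulrDl lerD.
Qed.

Lemma prod_norm_le V W (v : V * W) : `|v| <= `|v.1| + `|v.2|.
Proof.
rewrite prod_normE comparable_ge_max; last exact: real_comparable.
by rewrite lerDl lerDr !normr_ge0.
Qed.

Lemma fst_norm_le V W (v : V * W) : `|v.1| <= `|v|.
Proof. by rewrite prod_normE comparable_le_max ?lexx ?real_comparable. Qed.

Lemma snd_norm_le V W (v : V * W) : `|v.2| <= `|v|.
Proof.
by rewrite prod_normE comparable_le_max ?lexx ?orbT ?real_comparable.
Qed.

Lemma antidual_norm_ub V (phi : antidual V) x : `|phi x| <= `|phi| * `|x|.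
Proof.
have /asboolP[lin _] := antidualP phi.
have [->|x0] := eqVneq x 0; first by rewrite antidual_eval0 !normr0 mulr0.
have := antidual_norm_ub1 phi (x := `|x|^-1 *: x).
rewrite normrZ normfV normr_id mulVf ?normr_eq0 // => /(_ (lexx _)).
rewrite -[_ *: x]addr0 lin antidual_eval0 addr0 normrM norm_conjC.
by rewrite normfV normr_id mulrC ler_pdivrMr // normr_gt0.
Qed.

(** [adjoint] is a choice with default value 0; Riesz representation shows that there is a vector to
    choose, so the default never occurs here. The bound is only needed for the one [y'] in
    question. *)
Lemma adjointP (F : hilbertType R) (Y Y' : Type) (pY : Y' -> Y -> R[i])
    (B : F -> Y) y' :
  (forall a x y, pY y' (B (a *: x + y)) = a^* * pY y' (B x) + pY y' (B y)) ->
  (exists2 C : R[i], 0 <= C & forall x, `|pY y' (B x)| <= C * `|x|) ->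
  forall x, '[adjoint inner pY B y', x] = pY y' (B x).
Proof.
move=> lin [C C0 bnd]; rewrite /adjoint; case: xgetP => [y _ //|none].
have [|y yP] := riesz (M := complex.Re C) lin.
  by move=> x; rewrite RRe_real ?ger0_real.
by have := none y.
Qed.

End BoundedOp.

(** * Resolvents of an operator and their adjoints when it is self-adjoint *)

Section Resolvent.
Variables (R : realType) (F : hilbertType R) (T : operator F).
Implicit Types (f g x y : F) (z : R[i]).

Lemma op0 : T 0 = 0.
Proof.
have := Defs.appP 1 (dom0 T) (dom0 T); rewrite scaler0 addr0 scale1r => /eqP.
by rewrite -subr_eq subrr eq_sym => /eqP.
Qed.

Lemma domZ a x : dom T x -> dom T (a *: x).
Proof.
by move=> Tx; rewrite -[_ *: _]addr0; apply: domP => //; apply: dom0.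
Qed.

Lemma domB x y : dom T x -> dom T y -> dom T (x - y).
Proof. by move=> Tx Ty; rewrite -scaleN1r addrC; apply: domP. Qed.

Lemma opD x y : dom T x -> dom T y -> T (x + y) = T x + T y.
Proof. by move=> Tx Ty; rewrite -{1}[x]scale1r Defs.appP // scale1r. Qed.

Lemma opZ a x : dom T x -> T (a *: x) = a *: T x.
Proof.
by move=> Tx; rewrite -[a *: x]addr0 Defs.appP ?op0 ?addr0 //; apply: dom0.
Qed.

Lemma opB x y : dom T x -> dom T y -> T (x - y) = T x - T y.
Proof.
by move=> Tx Ty; rewrite addrC -scaleN1r Defs.appP // scaleN1r addrC.
Qed.

Lemma shiftB z x y : dom T x -> dom T y ->
  - T (x - y) + z *: (x - y) = (- T x + z *: x) - (- T y + z *: y).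
Proof. by move=> Tx Ty; rewrite opB // scalerBr !opprD addrACA. Qed.

Variable z : R[i].
Hypothesis zT : resolvent_set T z.

Lemma resolvent_dom f : dom T (resolvent T z f).
Proof.
have [zbij _] := zT.
by have [+ _ _] := bijpinv_bij (fun=> 0) zbij; apply.
Qed.

Lemma resolventK f : - T (resolvent T z f) + z *: resolvent T z f = f.
Proof.
have [[_ _ zsurj] _] := zT.
by rewrite (surjpK (fun=> 0) zsurj (x := f)) // inE.
Qed.

Lemma resolventE f : T (resolvent T z f) = z *: resolvent T z f - f.
Proof. by rewrite -{3}(resolventK f) opprD addrCA subrr addr0 opprK. Qed.

Lemma resolventKV x : dom T x -> resolvent T z (- T x + z *: x) = x.
Proof.
by have [[_ zinj _] _] := zT => Tx; apply: (pinvKV (fun=> 0) zinj); rewrite inE.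
Qed.

Lemma resolvent_linear : linear (resolvent T z).
Proof.
move=> a f g; have Df := resolvent_dom f; have Dg := resolvent_dom g.
rewrite -[RHS]resolventKV ?Defs.appP //; last exact: domP.
by rewrite !resolventE scalerBr scalerDr opprD !opprB !scalerA (mulrC a);
  rewrite addrACA [_ - _ + _]subrK [_ - _ + _]subrK.
Qed.

Hypothesis saT : selfadjoint T.

Lemma selfadjoint_sym x y : dom T x -> dom T y -> '[T x, y] = '[x, T y].
Proof. by move=> Tx Ty; have [_ ->] := saT.2 y (T y). Qed.

Lemma shift_sym x y : dom T x -> dom T y ->
  '[- T x + z *: x, y] = '[x, - T y + z^* *: y].
Proof.
move=> Tx Ty; rewrite linearDl linearNl linearZl_LR linearDr linearNr.
by rewrite linearZr_LR /= conjCK selfadjoint_sym.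
Qed.

(** Tested on f = (z - T) x, the hypothesis says that [w] is in the domain of the adjoint of [T],
    with value conj(z) w - g; the adjoint is [T] itself. *)
Lemma resolvent_adjoint_eq g w : (forall f, '[resolvent T z f, g] = '[f, w]) ->
  dom T w /\ - T w + z^* *: w = g.
Proof.
move=> wP; have [|Tw TwE] := (saT.2 w (z^* *: w - g)).1.
  move=> x Tx; have := wP (- T x + z *: x); rewrite resolventKV //.
  rewrite linearDl linearNl linearZl_LR linearBr linearZr_LR /= conjCK.
  by move=> ->; rewrite opprD opprK addrCA subrr addr0.
by split=> //; rewrite -TwE opprB subrK.
Qed.

(** Riesz gives the Hilbert adjoint of R_z, and it is a right inverse of conj(z) - T. Injectivity
    holds because a kernel vector is orthogonal to the range of z - T, which is everything. *)
Lemma resolvent_set_conj : resolvent_set T z^*.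
Proof.
have [_ /bounded_opE[C C0 RC]] := zT.
have ex g : exists w, forall f, '[resolvent T z f, g] = '[f, w].
  have [a x y|x|w wP] := riesz (phi := fun f => '[g, resolvent T z f])
    (M := complex.Re (`|g| * C)).
  - by rewrite resolvent_linear inner_linearr.
  - rewrite RRe_real ?ger0_real ?mulr_ge0 //.
    by apply: le_trans (inner_le_norm _ _) _; rewrite -mulrA ler_wpM2l.
  by exists w => f; rewrite innerC -wP -innerC.
have bij : set_bij (dom T) setT (fun x => - T x + z^* *: x).
  split=> // [x y|g _]; last first.
    by have [w /resolvent_adjoint_eq[Tw <-]] := ex g; exists w.
  rewrite !inE => Tx Ty xy; apply/eqP; rewrite -subr_eq0; apply/eqP.
  apply: inner_eq0 => f; rewrite -(resolventK f) innerC.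
  rewrite shift_sym ?shiftB ?xy ?subrr ?linear0r ?conjC0 //.
    exact: resolvent_dom.
  exact: domB.
split=> //; apply: (bounded_opI C0) => g.
have [w wP] := ex g; have [Tw wE] := resolvent_adjoint_eq wP.
have -> : resolvent T z^* g = w.
  have [_ zinj _] := bij.
  by rewrite -wE; apply: (pinvKV (fun=> 0) zinj); rewrite inE.
have [->|w0] := eqVneq w 0; first by rewrite normr0 mulr_ge0.
(* The norm bound C passes to the adjoint: |w|^2 = <R_z w, g> <= C |w| |g|. *)
rewrite -(ler_pM2r (x := `|w|)) ?normr_gt0 // -expr2.
rewrite -(ger0_norm (exprn_ge0 2 (normr_ge0 w))) -inner_normE -wP.
apply: le_trans (inner_le_norm _ _) _.
by rewrite [leRHS]mulrAC ler_wpM2r.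
Qed.

End Resolvent.

Lemma resolvent_adjoint (R : realType) (F : hilbertType R) (T : operator F)
    (z : R[i]) (f g : F) : selfadjoint T -> resolvent_set T z ->
  '[resolvent T z f, g] = '[f, resolvent T z^* g].
Proof.
move=> saT zT; have zT' := resolvent_set_conj zT saT.
rewrite -{1}(resolventK zT' g) -shift_sym ?resolventK //; exact: resolvent_dom.
Qed.

Lemma conj_real_complex (R : realType) (r : R) : (r%:C)^*%R = r%:C.
Proof. by apply/CrealP; rewrite complex_real. Qed.

Lemma resolvent_identity (R : realType) (F : hilbertType R) (T : operator F)
    (w z : R[i]) (f : F) : resolvent_set T w -> resolvent_set T z ->
  resolvent T w f - resolvent T z f =
  (z - w) *: resolvent T w (resolvent T z f).
Proof.
move=> wT zT; have Df := resolvent_dom zT f.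
rewrite -{1}(resolventKV wT Df).
rewrite (_ : - _ + _ = (w - z) *: resolvent T z f + f); last first.
  by rewrite -[X in _ = _ + X](resolventK zT f) scalerBl [RHS]addrCA subrK.
by rewrite resolvent_linear // opprD addrCA subrr addr0 -scaleNr opprB.
Qed.

(** * Operators from linear graphs, and a criterion for self-adjointness *)

Section SelfadjointGraph.
Variables (R : realType) (F : hilbertType R) (gr : F -> F -> Prop).

(** By linearity, single-valuedness over 0 gives it everywhere; the operator then picks the unique
    value on its domain. *)
Lemma graph_operator :
  gr 0 0 -> (forall a g h g' h', gr g h -> gr g' h' ->
    gr (a *: g + g') (a *: h + h')) ->
  (forall h, gr 0 h -> h = 0) ->
  exists L : operator F, forall g h, gr g h <-> dom L g /\ h = L g.
Proof.
move=> gr0 grlin grfun.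
have gr_inj g h h' : gr g h -> gr g h' -> h = h'.
  move=> gh gh'; apply/eqP; rewrite -subr_eq0; apply/eqP/grfun.
  by have := grlin (-1) _ _ _ _ gh' gh; rewrite !scaleN1r addNr addrC.
pose D := [set g | exists h, gr g h].
pose app g := xget 0 [set h | gr g h].
have appP g h : gr g h -> gr g (app g).
  by move=> gh; apply: (xgetPex 0 (P := [set h | gr g h])); exists h.
have domP a x y : D x -> D y -> D (a *: x + y).
  by move=> [h xh] [h' yh']; exists (a *: h + h'); apply: grlin.
have app_lin a x y : D x -> D y -> app (a *: x + y) = a *: app x + app y.
  move=> [h /appP xh] [h' /appP yh']; apply: gr_inj (grlin a _ _ _ _ xh yh').
  exact: appP (grlin a _ _ _ _ xh yh').
exists (Operator (ex_intro _ 0 gr0 : D 0) domP app_lin) => g h.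
split=> [gh|[]] /=.
  by split; [exists h|apply: gr_inj gh (appP _ _ gh)].
by move=> [h' /appP gh'] ->.
Qed.

End SelfadjointGraph.

Section SelfadjointOperator.
Variables (R : realType) (F : hilbertType R) (L : operator F).

(** One surjectivity condition is enough because [l] is real: l - L is then symmetric too, so its
    range also serves to test vectors against the adjoint. Density of the domain comes for free. *)
Lemma selfadjoint_of_surj (l : R) :
  (forall x y, dom L x -> dom L y -> '[L x, y] = '[x, L y]) ->
  (forall f, exists2 g, dom L g & - L g + l%:C *: g = f) ->
  selfadjoint L.
Proof.
move=> Lsym Lsurj.
have shift x y : dom L x -> dom L y ->
    '[- L x + l%:C *: x, y] = '[x, - L y + l%:C *: y].
  move=> Lx Ly; rewrite linearDl linearNl linearZl_LR linearDr linearNr.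
  by rewrite linearZr_LR /= conj_real_complex Lsym.
split.
  apply: dense_orthogonal => [|u uP].
    by split=> [|a x y]; [exact: dom0|exact: domP].
  have [g Lg gE] := Lsurj u.
  (* Writing u = (l - L) g, orthogonality of [u] to the domain makes [g] orthogonal to the range of
     l - L. *)
  suff g0 : g = 0 by rewrite -gE g0 op0 oppr0 scaler0 addr0.
  apply: inner_inj => f; have [x Lx <-] := Lsurj f.
  by rewrite -shift // gE uP // linear0l.
move=> y w; split=> [yw|[Ly ->] x Lx]; last exact: Lsym.
(* If [w] is the adjoint value at [y], then [g] solves the equation that [y] should solve; y - g is
   orthogonal to the range of l - L, hence zero. *)
have [g Lg gE] := Lsurj (l%:C *: y - w).
have yg : y = g.
  apply: inner_inj => f; have [x Lx <-] := Lsurj f.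
  rewrite innerC [RHS]innerC; congr (Num.conj _); rewrite [RHS]shift // gE.
  rewrite linearDl linearNl linearZl_LR /=.
  rewrite yw // linearBr linearZr_LR /= conj_real_complex.
  by rewrite [in LHS]addrC.
split; first by rewrite yg.
by move: gE; rewrite -yg addrC => /addrI/oppr_inj.
Qed.

Lemma resolventP (z : R[i]) (K : F -> F) : bounded_op K ->
  (forall f, dom L (K f) /\ - L (K f) + z *: K f = f) ->
  (forall x, dom L x -> K (- L x + z *: x) = x) ->
  resolvent_set L z /\ resolvent L z =1 K.
Proof.
move=> Kbnd KP KV.
have bij : set_bij (dom L) setT (fun x => - L x + z *: x).
  split=> // [x y|f _]; last by have [LK <-] := KP f; exists (K f).
  by rewrite !inE => Lx Ly /(congr1 K); rewrite !KV.
have E : resolvent L z =1 K.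
  have [_ zinj _] := bij => f; have [LK {1}<-] := KP f.
  by apply: (pinvKV (fun=> 0) zinj); rewrite inE.
by split=> //; split=> //; rewrite (funext E).
Qed.

End SelfadjointOperator.

(** * The space H_1 and the duality between F (+) H_{-1} and F (+) H_1 *)

Section Pairing.
Variables (R : realType) (F : hilbertType R) (H : operator F).
Implicit Types (v : F * Hm1 H) (u : F * H1 H) (a : R[i]).

Lemma toH1K (x : F) : dom H x -> toH1 H x = x :> F.
Proof. by move=> Hx; apply: insubdK; apply/asboolP. Qed.

Lemma H1_inj (x y : H1 H) : x = y :> F -> x = y.
Proof. exact: val_inj. Qed.

Lemma pairing_linearr v a u1 u2 :
  pairing v (a *: u1 + u2) = a^* * pairing v u1 + pairing v u2.
Proof.
have /asboolP[lin _] := antidualP v.2.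
by rewrite /pairing /= inner_linearr lin mulrDr addrACA.
Qed.

Lemma pairing_linearl u a v1 v2 :
  pairing (a *: v1 + v2) u = a * pairing v1 u + pairing v2 u.
Proof. by rewrite /pairing /= inner_linearl mulrDr addrACA. Qed.

Lemma pairing_bounded v u : `|pairing v u| <= `|v| * `|u| + `|v| * `|u|.
Proof.
apply: le_trans (ler_normD _ _) _; apply: lerD.
  apply: le_trans (inner_le_norm _ _) _.
  by apply: ler_pM => //; exact: fst_norm_le.
apply: le_trans (antidual_norm_ub _ _) _.
by apply: ler_pM => //; [exact: (snd_norm_le v)|exact: snd_norm_le].
Qed.

Lemma pairing_inclE (p : F * F) u :
  pairing (Defs.incl H p) u = '[p.1, u.1] + '[p.2, u.2 : F].
Proof. by []. Qed.

(** The embedded vectors of F (+) F already separate the points of F (+) H_1. *)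
Lemma pairing_inj u1 u2 : (forall v, pairing v u1 = pairing v u2) -> u1 = u2.
Proof.
move=> u12; have E (p : F * F) := u12 (Defs.incl H p).
have inner0 (x y : F) : (forall f, '[f, x] = '[f, y]) -> x = y.
  by move=> xy; apply: inner_inj => f; rewrite innerC xy -innerC.
rewrite [u1]surjective_pairing [u2]surjective_pairing; congr (_, _).
  apply: inner0 => f; have := E (f, 0).
  by rewrite !pairing_inclE /= !linear0l !addr0.
apply/H1_inj/inner0 => f; have := E (0, f).
by rewrite !pairing_inclE /= !linear0l !add0r.
Qed.

Lemma embed_linear : linear (embed H).
Proof.
by move=> a f g; apply: val_inj; apply/funext => x; rewrite /= inner_linearl.
Qed.

Lemma incl_linear : linear (Defs.incl H).
Proof. by move=> a p q; rewrite /Defs.incl /= embed_linear. Qed.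

Lemma resolventH1E z f : resolvent_set H z ->
  resolventH1 H z f = resolvent H z f :> F.
Proof. by move=> zH; apply/toH1K/resolvent_dom. Qed.

Lemma resolventH1_linear z : resolvent_set H z -> linear (resolventH1 H z).
Proof.
move=> zH a f g; apply: H1_inj.
by rewrite /= !resolventH1E // resolvent_linear.
Qed.

Lemma H1_norm_le (x : H1 H) : `|x| <= `|H x| + `|x : F|.
Proof.
rewrite -(ler_pXn2r (n := 2)) ?nnegrE ?addr_ge0 //.
rewrite sqr_norm_inner /= /H1inner !inner_normE sqrrD.
by rewrite lerD2r lerDl mulrn_wge0 ?mulr_ge0.
Qed.

Lemma resolventH1_bounded z : resolvent_set H z -> bounded_op (resolventH1 H z).
Proof.
move=> zH; have [_ /bounded_opE[C C0 RC]] := zH.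
(* Since H R_z = z R_z - 1, the first two terms bound H R_z f, and the last one bounds R_z f. *)
apply: (@bounded_opI _ _ _ _ (`|z| * C + 1 + C)) => [|f].
  by rewrite !addr_ge0 ?mulr_ge0.
apply: le_trans (H1_norm_le _) _; rewrite resolventH1E // resolventE //.
rewrite mulrDl lerD // mulrDl mul1r -mulrA.
apply: le_trans (ler_normB _ _) _.
by rewrite lerD2r normrZ ler_wpM2l.
Qed.

End Pairing.

(** * The operators G_z and their bold versions: adjoints, bounds, dependence on z *)

Section Krein.
Variables (R : realType) (F : hilbertType R) (H : operator F).
Variables (A : {linear H1 H -> F}).
Hypotheses (saH : selfadjoint H) (A_bounded : bounded_op A).
Implicit Types (z w : R[i]) (f g : F) (v : F * Hm1 H).

Lemma bA_linear : linear (bA A).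
Proof. by move=> a x y; rewrite /bA linearP. Qed.

Lemma bA_bounded : bounded_op (bA A).
Proof.
have [C C0 AC] := bounded_opE A_bounded.
apply: (@bounded_opI _ _ _ _ (C + 1)) => [|x]; first exact: addr_ge0.
by apply: le_trans (prod_norm_le _) _; rewrite /= mulrDl mul1r lerD.
Qed.

Lemma bA_resolvent_linear z : resolvent_set H z ->
  linear (bA A \o resolventH1 H z).
Proof. by move=> zH a f g; rewrite /= resolventH1_linear // bA_linear. Qed.

Lemma bA_resolvent_bounded z : resolvent_set H z ->
  bounded_op (bA A \o resolventH1 H z).
Proof.
move=> zH; exact: bounded_op_comp (resolventH1_bounded zH) bA_bounded.
Qed.

Lemma bG_inner z v f : resolvent_set H z ->
  '[bG A z v, f] = pairing v (bA A (resolventH1 H z^* f)).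
Proof.
move=> /resolvent_set_conj/(_ saH) zH.
have [C C0 RC] := bounded_opE (bA_resolvent_bounded zH).
apply: (adjointP (pY := @pairing _ _ H)) => [a x y|].
  by rewrite bA_resolvent_linear // pairing_linearr.
exists (`|v| * C + `|v| * C) => [|x]; first by rewrite addr_ge0 ?mulr_ge0.
apply: le_trans (pairing_bounded _ _) _.
by rewrite mulrDl -!mulrA lerD // ler_wpM2l.
Qed.

Lemma G_inner z f g : resolvent_set H z ->
  '[G A z f, g] = '[f, A (resolventH1 H z^* g)].
Proof.
move=> /resolvent_set_conj/(_ saH) zH.
have [C C0 RC] := bounded_opE
  (bounded_op_comp (resolventH1_bounded zH) A_bounded).
apply: (adjointP (pY := inner)) => [a x y|].
  by rewrite /= resolventH1_linear // linearP inner_linearr.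
exists (`|f| * C) => [|x]; first exact: mulr_ge0.
by apply: le_trans (inner_le_norm _ _) _; rewrite -mulrA ler_wpM2l.
Qed.

(** On embedded vectors the extension of R_z to H_{-1} is the ordinary resolvent. *)
Lemma bG_incl z (p : F * F) : resolvent_set H z ->
  bG A z (Defs.incl H p) = G A z p.1 + resolvent H z p.2.
Proof.
move=> zH; apply: inner_inj => f.
rewrite bG_inner // pairing_inclE linearDl /= G_inner //.
rewrite (resolvent_adjoint _ _ saH zH) resolventH1E //.
exact: resolvent_set_conj.
Qed.

Lemma bG_linear z : resolvent_set H z -> linear (bG A z).
Proof.
move=> zH a v1 v2; apply: inner_inj => f.
by rewrite inner_linearl !bG_inner // pairing_linearl.
Qed.

Lemma bG_bounded z : resolvent_set H z -> bounded_op (bG A z).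
Proof.
move=> zH; have zH' := resolvent_set_conj zH saH.
have [C C0 RC] := bounded_opE (bA_resolvent_bounded zH').
(* By duality |g|^2 is the pairing of [v] with the image of [g] under bA R at conj(z); the two
   copies of [C] come from the two components of the pairing. *)
apply: (@bounded_opI _ _ _ _ (C + C)) => [|v]; first exact: addr_ge0.
set g := bG A z v; have [->|g0] := eqVneq g 0.
  by rewrite normr0 mulr_ge0 ?addr_ge0.
rewrite -(ler_pM2r (x := `|g|)) ?normr_gt0 // -expr2.
rewrite -(ger0_norm (exprn_ge0 2 (normr_ge0 g))) -inner_normE bG_inner //.
apply: le_trans (pairing_bounded _ _) _.
rewrite mulrAC mulrDl mulrDl.
by apply: lerD; rewrite mulrC ler_wpM2r //; exact: RC.
Qed.

(** The defining identity of [bG] exhibits an adjoint vector, and nondegeneracy of the pairing makes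
    it the one that was chosen. *)
Lemma bG_adjE z f : resolvent_set H z ->
  bG_adj A z f = bA A (resolventH1 H z^* f).
Proof.
move=> zH; rewrite /bG_adj /adjoint.
have E v : pairingC (bA A (resolventH1 H z^* f)) v = '[f, bG A z v].
  by rewrite /pairingC -bG_inner // -innerC.
case: xgetP => [u _ uP|none]; last by have := none _ E.
apply: pairing_inj => v; apply: (can_inj (@conjCK _)).
by rewrite -[LHS]/(pairingC u v) uP -E.
Qed.

Lemma G_adjE z f : resolvent_set H z ->
  adjoint inner inner (G A z) f = A (resolventH1 H z^* f).
Proof.
move=> zH; rewrite /adjoint.
have E g : '[A (resolventH1 H z^* f), g] = '[f, G A z g].
  by rewrite innerC -G_inner // -innerC.
case: xgetP => [u _ uP|none]; last by have := none _ E.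
by apply: inner_inj => g; rewrite uP E.
Qed.

(** This is the dual of the resolvent identity between conj(w) and conj(z). It puts the difference
    into dom H, as the definition of [bM] requires. *)
Lemma bG_sub w z v : resolvent_set H w -> resolvent_set H z ->
  bG A w v - bG A z v = (z - w) *: resolvent H z (bG A w v).
Proof.
move=> wH zH; have wH' := resolvent_set_conj wH saH.
have zH' := resolvent_set_conj zH saH.
apply: inner_inj => f; rewrite linearBl linearZl_LR /=.
rewrite (resolvent_adjoint _ _ saH zH) !bG_inner //.
have -> : resolventH1 H w^* f =
    (z - w)^* *: resolventH1 H w^* (resolvent H z^* f) + resolventH1 H z^* f.
  apply: H1_inj; rewrite /= !resolventH1E // rmorphB.
  by rewrite -resolvent_identity // subrK.
by rewrite bA_linear pairing_linearr conjCK addrK.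
Qed.

End Krein.

(** * The relation that describes L, and its link with the resolvent formula *)

Section KreinGraph.
Variables (R : realType) (F : hilbertType R) (H : operator F).
Variables (A : {linear H1 H -> F}) (S : operator F) (l0 : R).
Hypotheses (saH : selfadjoint H) (A_bounded : bounded_op A).
Hypotheses (symS : symmetric_op S) (HS : dom H `<=` dom S).
Hypothesis l0H : resolvent_set H l0%:C.

Let Theta := bTheta A S l0.
Let Gp (p : F * F) := bG A l0%:C (Defs.incl H p).

Definition krein_graph (g h : F) := exists p g0,
  [/\ frakD A l0 p.1, Theta p = bA A g0,
      g = (g0 : F) + Gp p & h = H g0 + l0%:C *: Gp p].

Let G0 := G A l0%:C.
Let RH1 := resolventH1 H l0%:C.

Lemma G_linear z : resolvent_set H z -> linear (G A z).
Proof.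
move=> zH a f g; apply: inner_inj => x.
by rewrite inner_linearl !G_inner // inner_linearl.
Qed.

Let Gadj f : adjoint inner inner G0 f = A (RH1 f).
Proof. by rewrite G_adjE // conj_real_complex. Qed.

Let oneG p := toH1 H (p - G0 p).

Let oneGE p : frakD A l0 p -> oneG p = p - G0 p :> F.
Proof. exact: toH1K. Qed.

Let bThetaE p : frakD A l0 p.1 -> Theta p =
  (S (oneG p.1) - A (RH1 (S (oneG p.1))) + (p.2 - A (RH1 p.2)),
   oneG p.1 - RH1 p.2).
Proof. by move=> Dp; rewrite /Theta /bTheta /T_S !Gadj oneGE. Qed.

Lemma frakD_subspace : linear_subspace (frakD A l0).
Proof.
have E a p q : a *: p + q - G0 (a *: p + q) = a *: (p - G0 p) + (q - G0 q).
  by rewrite /G0 G_linear // scalerBr opprD addrACA.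
split=> [|a p q]; rewrite /frakD /= -/G0; last by rewrite E; apply: domP.
have -> : G0 0 = 0 by apply: inner_inj => x; rewrite /G0 G_inner // !linear0l.
by rewrite subr0; exact: dom0.
Qed.

Lemma bTheta_linear a p q : frakD A l0 p.1 -> frakD A l0 q.1 ->
  Theta (a *: p + q) = a *: Theta p + Theta q.
Proof.
move=> Dp Dq; have Dpq := frakD_subspace.2 a _ _ Dp Dq.
rewrite !bThetaE //.
have E : oneG (a *: p + q).1 = a *: oneG p.1 + oneG q.1.
  apply: H1_inj; rewrite /= !oneGE //.
  by rewrite /G0 G_linear // scalerBr opprD addrACA.
have RL := resolventH1_linear l0H.
have SE : S (oneG (a *: p + q).1) = a *: S (oneG p.1) + S (oneG q.1).
  by rewrite E /= Defs.appP //; apply/HS/H1dom.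
rewrite SE E /= /RH1 !RL !linearP /=; congr (_, _) => /=; last first.
  by rewrite scalerDr addrACA.
rewrite !scalerDr [X in X + _ = _]addrACA [X in _ + X = _]addrACA.
by rewrite [LHS]addrACA.
Qed.

(** The adjoint of 1 - G moves to the other side as 1 - G, which reduces the corner block to the
    symmetric form of [S] and makes the off-diagonal blocks adjoint to each other; R is symmetric
    because [l0] is real. *)
Lemma bTheta_symmetric p q : frakD A l0 p.1 -> frakD A l0 q.1 ->
  pairing (Defs.incl H p) (Theta q) = (pairing (Defs.incl H q) (Theta p))^*.
Proof.
move=> Dp Dq; rewrite !pairing_inclE !bThetaE //=.
have GE x y : frakD A l0 x -> '[x, y - A (RH1 y)] = '[oneG x : F, y].
  move=> Dx; rewrite linearBr /= oneGE // linearBl /= G_inner //.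
  by rewrite conj_real_complex.
have GE2 x y y' : frakD A l0 x ->
    '[x, y - A (RH1 y) + (y' - A (RH1 y'))] =
    '[oneG x : F, y] + '[oneG x : F, y'].
  by move=> Dx; rewrite linearDr /= !GE.
rewrite !GE2 // !linearBr /= !resolventH1E // !(rmorphD, rmorphN) /= -!innerC.
rewrite symS.2; [|exact/HS/H1dom..].
rewrite (resolvent_adjoint _ _ saH l0H) conj_real_complex.
by rewrite -!addrA; congr (_ + _); rewrite addrCA.
Qed.

(** With k = l0 - H one has h = l0 g - k g0, so only <k g0, g'> = <g, k g0'> is at stake. As <G p, k
    x> is the pairing of p with bA x, the relation Theta p = bA g0 turns the cross terms into the
    form of Theta. *)
Lemma krein_graph_symmetric g h g' h' :
  krein_graph g h -> krein_graph g' h' -> '[h, g'] = '[g, h'].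
Proof.
move=> [p [g0 [Dp Tp -> ->]]] [p' [g0' [Dp' Tp' -> ->]]].
pose k (x : H1 H) : F := - H x + l0%:C *: (x : F).
have RK x : RH1 (k x) = x.
  by apply: H1_inj; rewrite resolventH1E // resolventKV //; exact: H1dom.
have E (x : H1 H) y : H x + l0%:C *: y = l0%:C *: ((x : F) + y) - k x.
  by rewrite /k scalerDr opprD opprK [RHS]addrC addrA subrK.
have K q (x : H1 H) : '[Gp q, k x] = pairing (Defs.incl H q) (bA A x).
  by rewrite /Gp bG_inner // conj_real_complex -/RH1 RK.
rewrite !E linearBl linearBr linearZl_LR linearZr_LR /= conj_real_complex.
congr (_ - _).
rewrite linearDr [RHS]linearDl /=; congr (_ + _).
  by rewrite /k shift_sym ?conj_real_complex //; exact: H1dom.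
by rewrite innerC !K // -Tp -Tp' -bTheta_symmetric.
Qed.

Lemma krein_graph_linear a g h g' h' : krein_graph g h -> krein_graph g' h' ->
  krein_graph (a *: g + g') (a *: h + h').
Proof.
move=> [p [g0 [Dp Tp -> ->]]] [p' [g0' [Dp' Tp' -> ->]]].
exists (a *: p + p'), (a *: g0 + g0'); split.
- exact: frakD_subspace.2.
- by rewrite bTheta_linear // Tp Tp' bA_linear.
- by rewrite /Gp incl_linear bG_linear //= scalerDr addrACA.
- rewrite /Gp incl_linear bG_linear //= Defs.appP; try exact: H1dom.
  by rewrite !scalerDr !scalerA mulrC addrACA.
Qed.

Lemma krein_graph0 : krein_graph 0 0.
Proof.
have Gp0 : Gp 0 = 0.
  apply: inner_inj => x; rewrite /Gp bG_inner // pairing_inclE !linear0l.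
  by rewrite addr0.
exists 0, 0; rewrite Gp0 scaler0 addr0 op0 addr0; split=> //.
  exact: frakD_subspace.1.
have := bTheta_linear (-1) frakD_subspace.1 frakD_subspace.1 (p := 0) (q := 0).
by rewrite scaler0 addr0 scaleN1r addNr => ->; rewrite /bA linear0.
Qed.

(** If g = 0, then g0 = - G p, so G_l0 p.1 lies in dom H and vanishes. The second component of Theta
    p = bA g0 then gives p.1 = 0, and the first gives p.2 = 0. *)
Lemma krein_graph_functional h : range (G A l0%:C) `&` dom H = [set 0] ->
  krein_graph 0 h -> h = 0.
Proof.
move=> GH [p [g0 [Dp Tp /esym/eqP]]]; rewrite addr_eq0 => /eqP g0E ->.
have GpE : Gp p = G0 p.1 + (RH1 p.2 : F) by rewrite /Gp bG_incl // resolventH1E.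
have G0p : G0 p.1 = 0.
  suff : (range G0 `&` dom H) (G0 p.1) by rewrite /G0 GH.
  split; first by exists p.1.
  rewrite (_ : G0 p.1 = - (g0 + RH1 p.2 : H1 H) :> F); last first.
    by rewrite /= g0E GpE opprD opprK addrK.
  by rewrite -scaleN1r; apply/domZ/H1dom.
have g0E' : g0 = - RH1 p.2 by apply: H1_inj; rewrite g0E GpE G0p add0r.
move: Tp; rewrite bThetaE // /bA => -[].
rewrite g0E' => T1 /(canRL (addrK _)); rewrite subrr => T2.
have p1 : p.1 = 0 by rewrite -[p.1]subr0 -[X in _ - X]G0p -oneGE // T2.
have RH10 : RH1 0 = 0.
  have := resolventH1_linear l0H (-1) 0 0.
  by rewrite scaler0 addr0 scaleN1r addNr.
move: T1; rewrite T2 op0 RH10 linear0 subr0 add0r linearN /=.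
rewrite -[RHS]add0r => /addIr p2.
rewrite /Gp bG_incl // -/G0 G0p p2 -resolventH1E // -/RH1 RH10.
by rewrite oppr0 /= op0 addr0 scaler0 addr0.
Qed.

Let bA_sub (x y : H1 H) : bA A (x - y) = bA A x - bA A y.
Proof. by rewrite /bA linearB. Qed.

Let bA_add (x y : H1 H) : bA A (x + y) = bA A x + bA A y.
Proof. by rewrite /bA linearD. Qed.

Let diffE z p : resolvent_set H z ->
  toH1 H (Gp p - bG A z (Defs.incl H p)) = Gp p - bG A z (Defs.incl H p) :> F.
Proof.
by move=> zH; rewrite toH1K // bG_sub //; apply: domZ; exact: resolvent_dom.
Qed.

(** By [bG_sub], m = (z - l0) R_z G p, and z - H cancels R_z. *)
Let diff_op z p : resolvent_set H z ->
  let m := toH1 H (Gp p - bG A z (Defs.incl H p)) in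
  - H m + z *: (m : F) = (z - l0%:C) *: Gp p.
Proof.
move=> zH m; rewrite /m diffE // bG_sub // opZ; last exact: resolvent_dom.
by rewrite scalerA mulrC -scalerA -scalerN -scalerDr resolventK.
Qed.

Lemma krein_graph_shift z f p : resolvent_set H z -> frakD A l0 p.1 ->
  bThetaM A S l0 z p = bA A (resolventH1 H z f) ->
  let g := resolvent H z f + bG A z (Defs.incl H p) in
  krein_graph g (z *: g - f).
Proof.
move=> zH Dp TM g; pose m := toH1 H (Gp p - bG A z (Defs.incl H p)).
have mE : m = Gp p - bG A z (Defs.incl H p) :> F by rewrite /m diffE.
(* Since M_z p = bA m, the hypothesis reads Theta p = bA (R_z f - m), which dictates the dom H
   component of [g]. *)
have gE : g = ((resolventH1 H z f - m : H1 H) : F) + Gp p.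
  by rewrite /= resolventH1E // mE opprB -addrA subrK.
exists p, (resolventH1 H z f - m); split=> //.
  by rewrite bA_sub -TM addrK.
rewrite /= opB; try exact: H1dom.
rewrite gE /= resolventH1E // resolventE //.
have -> : H m = z *: (m : F) - (z - l0%:C) *: Gp p.
  by rewrite -diff_op // opprD opprK addrCA subrr addr0.
rewrite scalerDr scalerBr scalerBl opprB -[RHS]addrA.
rewrite [X in _ = _ + X]addrAC subrK.
by rewrite [LHS]addrAC [X in X + _ = _]addrAC -[LHS]addrA (addrC (- (z *: _))).
Qed.

Lemma krein_graph_shiftV z f g : resolvent_set H z ->
  krein_graph g (z *: g - f) -> exists p,
  [/\ frakD A l0 p.1, bThetaM A S l0 z p = bA A (resolventH1 H z f) &
  g = resolvent H z f + bG A z (Defs.incl H p)].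
Proof.
move=> zH [p [g0 [Dp Tp gE hE]]]; exists p.
pose m := toH1 H (Gp p - bG A z (Defs.incl H p)).
have mE : m = Gp p - bG A z (Defs.incl H p) :> F by rewrite /m diffE.
(* Apply z - H to g0 + m: the result is (z - H) g0 + (z - l0) G p = z g - h = f. *)
have RE : resolventH1 H z f = g0 + m.
  apply: H1_inj; rewrite resolventH1E //.
  rewrite -[RHS](resolventKV zH (H1dom (g0 + m))) /=.
  congr (resolvent _ _ _).
  have -> : f = z *: g - (H g0 + l0%:C *: Gp p).
    by rewrite -hE opprB addrC subrK.
  rewrite gE opD; try exact: H1dom.
  rewrite !scalerDr !opprD [LHS]addrACA [RHS]addrACA diff_op // scalerBl.
  by rewrite [X in X + _ = _]addrC.
split=> //; first by rewrite RE bA_add -Tp.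
by rewrite -resolventH1E // RE /= mE gE addrA subrK.
Qed.

End KreinGraph.

Theorem theorem2p8 (R : realType) (F : hilbertType R)
  (H : operator F) (A : {linear H1 H -> F}) (S : operator F) (l0 : R) :
  selfadjoint H -> bounded_below H ->
  bounded_op A ->
  (forall z, resolvent_set H z -> range (G A z) `&` dom H = [set 0]) ->
  symmetric_op S -> dom H `<=` dom S ->
  (l0%:E < inf_spectrum H)%E ->
  Z_S A S l0 l0%:C ->
  exists L : operator F, selfadjoint L /\
    forall z, Z_S A S l0 z ->
      resolvent_set L z /\
      forall f, resolvent L z f =
        resolvent H z f + bG A z (bThetaM_inv A S l0 z (bG_adj A z^*%R f)).
Proof.
move=> saH _ A_bounded GH symS HS _ Zl0; have [l0H _ _] := Zl0.
pose gr := krein_graph A S l0.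
pose K z f := resolvent H z f +
  bG A z (bThetaM_inv A S l0 z (bG_adj A z^* f)).
(* Surjectivity of Theta + M_z supplies a solution [p], and injectivity identifies every solution
   with the value of the inverse in the formula. *)
have grK z f g : Z_S A S l0 z -> gr g (z *: g - f) <-> g = K z f.
  move=> [zH [_ Minj Msurj] _].
  have KE p : frakD A l0 p.1 ->
      bThetaM A S l0 z p = bA A (resolventH1 H z f) ->
      K z f = resolvent H z f + bG A z (Defs.incl H p).
    move=> Dp pE; rewrite /K bG_adjE //; last exact: resolvent_set_conj.
    rewrite conjCK -pE /bThetaM_inv /= (pinvKV (fun=> 0) Minj) //.
    by rewrite inE; split.
  split=> [/krein_graph_shiftV|->].
    by case=> // p [Dp pE ->]; rewrite (KE p).
  have [p [Dp _] pE] := Msurj (bA A (resolventH1 H z f)) I.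
  by rewrite (KE p) //; exact: krein_graph_shift.
have [L LP] := graph_operator (krein_graph0 saH A_bounded HS l0H)
  (krein_graph_linear saH A_bounded HS l0H)
  (fun h => krein_graph_functional saH A_bounded l0H (GH _ l0H)).
have LK z f : Z_S A S l0 z -> dom L (K z f) /\ - L (K z f) + z *: K z f = f.
  move=> Zz; have /(LP _ _)[LKf <-] := (grK z f _ Zz).2 erefl.
  by rewrite opprB subrK.
exists L; split.
  apply: (selfadjoint_of_surj (l := l0)) => [x y Lx Ly|f].
    by apply: (krein_graph_symmetric saH A_bounded symS HS l0H); apply/LP.
  (* The assumption that [l0] is in [Z_S] enters here: it makes l0 - L onto at a real point. *)
  by have [LKf fE] := LK _ f Zl0; exists (K l0%:C f).
move=> z Zz; have [zH _ invM] := Zz; apply: resolventP => [|f|x Lx].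
- have zH' := resolvent_set_conj zH saH.
  apply: bounded_opD; first exact: zH.2.
  apply: (bounded_op_comp
    (f := fun f => bThetaM_inv A S l0 z (bG_adj A z^* f))).
    apply: bounded_op_comp invM.
    rewrite (_ : bG_adj A z^* = bA A \o resolventH1 H z).
      exact: bA_resolvent_bounded.
    by apply/funext => f; rewrite bG_adjE // conjCK.
  exact: bG_bounded.
- exact: LK.
(* For f = (z - L) x the second entry z x - f is L x, so (x, L x) in the graph forces x = K z f. *)
- apply/esym/(grK z _ _ Zz).
  by rewrite opprD opprK addrCA subrr addr0; apply/LP.
Qed.
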